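(* Let $H\in(0,1]$, $a>0$, and let $Z^H=\{Z^H_{\ell,a}\}_{\ell\in\mathbb{Z}}$ be a fractional Gaussian noise with Hurst exponent $H$ and increment size $a$. For a permutation length $L$, let $b=(b_0,b_1,\ldots,b_{L-1})$ be a uniformly distributed random permutation of $(0,1,\ldots,L-1)$, and let $\phi$ be an independent random phase uniformly distributed on the set of integers $\{0,1,\ldots,L-1\}$. Then the new sequence $$\tilde Z^{H}=\{\tilde Z^H_\ell\}_{\ell\in\mathbb{Z}},\qquad \tilde Z^H_\ell=Z^H_{\overline{\ell}L+b_{\underline{\ell}}+\phi,\,a},$$ where $\ell=\overline{\ell}L+\underline{\ell}$ with $\overline{\ell}\in\mathbb{Z}$ and $0\le\underline{\ell}\le L-1$, has factorizable covariance in the limit of large permutation length $L$: for $q\neq 0$, $$\lim_{L\to\infty}K_{\tilde Z^H}(q)=\mathbb{E}\left[Z^H_{\overline{\ell}L+b_{\underline{\ell}}+\phi,\,a}\right]\mathbb{E}\left[Z^H_{\overline{\ell+q}\,L+b_{\underline{\ell+q}}+\phi,\,a}\right]=0 .$$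
   Context: Fractional Gaussian noise: for $H\in(0,1]$ and $a>0$, $Z^H_{\ell,a}=B^H_{\ell+a}-B^H_{\ell}$ is the increment sequence of a fractional Brownian motion $B^H$ with Hurst exponent $H$, a centered Gaussian self-similar process with covariance $\mathbb{E}[B^H_tB^H_s]=\frac{C^2}{2}\left(|t|^{2H}+|s|^{2H}-|t-s|^{2H}\right)$, where $C$ is a scale parameter. It is a centered stationary Gaussian sequence with $$\mathbb{E}\left[Z^H_{\ell,a}Z^H_{k,a}\right]=\frac{C^2}{2}\left(|\ell-k+a|^{2H}+|\ell-k-a|^{2H}-2|\ell-k|^{2H}\right).$$ For an integer $m$, $\overline{m}$ and $\underline{m}$ denote the quotient and the remainder of the division of $m$ by $L$. The same permutation $b$ is applied in every block of length $L$; uniform distribution of $b$ means that each of the $L!$ permutations has probability $1/L!$. The permutation $b$, the phase $\phi$ and $Z^H$ are mutually independent, and expectations are taken jointly over them. $K_{\tilde Z^H}(q)$ denotes the covariance of $\tilde Z^H$ at lag $q$, i.e. between two terms of $\tilde Z^H$ whose indices differ by $q$.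
   Formalization: The limit of the covariance is stated only for H < 1: at H = 1 with C ≠ 0 one has Z_ℓ = aξ for all ℓ, so K(q) = C²a² for every L and the limit is not 0. The vanishing product of expectations is kept for all H in (0,1]. *)

(* Defs.v *)
From HB Require Import structures.
From mathcomp Require Export all_boot all_order all_algebra all_fingroup.
From mathcomp Require Export all_classical all_reals all_analysis.
Import Order.TTheory GRing.Theory Num.Theory.
Import numFieldNormedType.Exports.

Set Implicit Arguments.
Unset Strict Implicit.
Unset Printing Implicit Defensive.

Local Open Scope classical_set_scope.
Local Open Scope ring_scope.

(* The variance 0 case is separate because [normal_prob m 0] is, by the
   library's convention, uniform on [0, 1] rather than the point mass at m. *)
Definition gaussian_law d (T : measurableType d) (R : realType)
    (P : probability T R) (X : T -> R) : Prop :=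
  (exists m s : R, 0 < s /\
     forall A : set R, measurable A -> P (X @^-1` A) = normal_prob m s A) \/
  (exists m : R,
     forall A : set R, measurable A -> P (X @^-1` A) = \d_m A).

Definition gaussian_process d (T : measurableType d) (R : realType)
    (P : probability T R) (I : Type) (X : I -> T -> R) : Prop :=
  forall (n : nat) (t : 'I_n -> I) (u : 'I_n -> R),
    gaussian_law P (fun w => \sum_(i < n) u i * X (t i) w).

(* (X_(ct))_t and (c^H X_t)_t have the same finite-dimensional laws; agreement
   on boxes suffices, boxes being a pi-system generating the Borel sets. *)
Definition self_similar d (T : measurableType d) (R : realType)
    (P : probability T R) (H : R) (X : R -> T -> R) : Prop :=
  forall (c : R) (n : nat) (t : 'I_n -> R) (A : 'I_n -> set R),
    0 < c -> (forall i, measurable (A i)) ->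
    P (\bigcap_(i in [set: 'I_n]) (X (c * t i) @^-1` A i)) =
    P (\bigcap_(i in [set: 'I_n]) ((fun w => c `^ H * X (t i) w) @^-1` A i)).

Record fractional_brownian_motion d (T : measurableType d) (R : realType)
    (P : probability T R) (H C : R) (B : R -> {RV P >-> R}) : Prop := {
  fbm_gaussian : gaussian_process P (fun t => B t : T -> R) ;
  fbm_self_similar : self_similar P H (fun t => B t : T -> R) ;
  fbm_centered : forall t : R, ('E_P[B t] = 0)%E ;
  fbm_covariance : forall t s : R,
    ('E_P[fun w => (B t w * B s w)%R] =
     (C ^+ 2 / 2 *
        (`|t| `^ (2 * H) + `|s| `^ (2 * H) - `|t - s| `^ (2 * H)))%R%:E)%E }.

Definition fractional_gaussian_noise d (T : measurableType d) (R : realType)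
    (P : probability T R) (B : R -> {RV P >-> R}) (a : R) (l : int) : T -> R :=
  fun w => B (l%:~R + a) w - B l%:~R w.

Definition uniform_rv d (T : measurableType d) (R : realType)
    (P : probability T R) (U : finType) (X : T -> U) : Prop :=
  (forall S : set U, measurable (X @^-1` S)) /\
  (forall x : U, P (X @^-1` [set x]) = (#|U|%:R^-1)%:E).

Definition sigma_finrv (T : Type) (U : finType) (X : T -> U) : set (set T) :=
  preimage_set_system setT X setT.

Definition sigma_process (T : Type) (R : realType) (I : Type) (X : I -> T -> R) :
    set (set T) :=
  <<s \bigcup_(i in [set: I]) preimage_set_system setT (X i) measurable >>.

(* For sigma-algebras the rules for pairs are the instances with one event
   equal to setT. *)
Definition independent3 d (T : measurableType d) (R : realType)
    (P : probability T R) (F G K : set (set T)) : Prop :=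
  forall A B D : set T, F A -> G B -> K D ->
    (P (A `&` B `&` D) = P A * P B * P D)%E.

(* The block length is L = n.+1: 'I_0 is empty, so no phase exists for L = 0.
   [divz] and [modz] are Euclidean, so the remainder of a negative l also lies
   in {0, ..., L - 1}. *)
Definition permuted_sequence (T : Type) (R : realType) (n : nat)
    (Z : int -> T -> R) (b : T -> 'S_n.+1) (phi : T -> 'I_n.+1) (l : int) :
    T -> R :=
  fun w => Z ((l %/ n.+1%:Z)%Z * n.+1%:Z
              + (b w (inord `|(l %% n.+1%:Z)%Z|%N) : nat)%:Z
              + (phi w : nat)%:Z) w.

(* Main.v *)
(* The permutation and the phase take finitely many values and are independent
   of the noise, so the mean of the permuted sequence vanishes, and its
   covariance is an average over permutations s of r(c + s i - s j): here r is
   the covariance of the noise, c is an integer multiple of L, and i, j are the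
   residues of the two indices modulo L, which differ once L > |q|. The phase
   cancels in the difference. Since (s i, s j) is uniform over pairs of distinct
   points, the average is at most 1/(L - 1) times the largest sum of |r| over L
   consecutive integers, which is o(L) because r(k) tends to 0 when H < 1. *)
Require Import Defs.
From mathcomp Require Import measurable_realfun.
From mathcomp Require Import ring lra zify.
Import Order.TTheory GRing.Theory Num.Theory.
Import numFieldNormedType.Exports.

Set Implicit Arguments.
Unset Strict Implicit.

Local Open Scope classical_set_scope.
Local Open Scope ring_scope.

(** * Covariance of the noise *)

(** Young's inequality for the factors [y ^ p] and 1, with conjugate exponents 1/p and 1/(1 - p). *)
Lemma powR_le_tangent1 (R : realType) (p y : R) :
  0 < p < 1 -> 0 <= y -> y `^ p <= 1 + p * (y - 1).
Proof.
move=> /andP[p0 p1] y0.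
have := @conjugate_powR R (y `^ p) 1 p^-1 (1 - p)^-1 (powR_ge0 _ _) ler01.
rewrite !invr_gt0 subr_gt0 !invrK subrKC => /(_ p0 p1 erefl).
by rewrite -powRrM mulfV ?gt_eqF// powRr1// powR1 mulr1; lra.
Qed.

(* With x ^ (2 H) = (x ^ 2) ^ H, the tangent inequality bounds the sum from
   above, and the AM-GM inequality from below by 2 (1 - u ^ 2) ^ H. *)
Lemma second_difference_powR (R : realType) (H u : R) :
  0 < H < 1 -> 0 <= u < 1 ->
  `|(1 + u) `^ (2 * H) + (1 - u) `^ (2 * H) - 2| <= 2 * u ^+ 2.
Proof.
move=> /andP[H0 H1] /andP[u0 u1].
have sq x : 0 <= x -> x `^ (2 * H) = (x ^+ 2) `^ H.
  by move=> x0; rewrite powRrM powR_mulrn.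
rewrite !sq; [|lra|lra].
have h1 : ((1 + u) ^+ 2) `^ H <= 1 + H * ((1 + u) ^+ 2 - 1).
  by apply: powR_le_tangent1; [apply/andP|rewrite sqr_ge0].
have h2 : ((1 - u) ^+ 2) `^ H <= 1 + H * ((1 - u) ^+ 2 - 1).
  by apply: powR_le_tangent1; [apply/andP|rewrite sqr_ge0].
have h3 : 1 - u ^+ 2 <= (1 + u) `^ H * (1 - u) `^ H.
  rewrite -powRM; [|lra|lra].
  have -> : (1 + u) * (1 - u) = 1 - u ^+ 2 by ring.
  by apply: ger1_powR; [apply/andP; split; nra|exact: ltW].
have sqH x : 0 <= x -> (x ^+ 2) `^ H = (x `^ H) ^+ 2.
  by move=> x0; rewrite -(powR_mulrn 2 x0) powRAC powR_mulrn// powR_ge0.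
rewrite ler_norml; apply/andP; split.
  by rewrite !sqH; [|lra|lra]; have := sqr_ge0 ((1 + u) `^ H - (1 - u) `^ H); nra.
by nra.
Qed.

Definition fgn_covariance (R : realType) (H C a x : R) : R :=
  C ^+ 2 / 2 * (`|x + a| `^ (2 * H) + `|x - a| `^ (2 * H) - 2 * `|x| `^ (2 * H)).

(** Factoring out [|x| ^ (2 H)] leaves a second difference at u = a/|x|, of order u ^ 2. For H < 1
    the resulting power of |x| forces decay. *)
Lemma fgn_covariance_bound (R : realType) (H C a x : R) :
  0 < H < 1 -> 0 < a < `|x| ->
  `|fgn_covariance H C a x| <= C ^+ 2 * a ^+ 2 / `|x| `^ (2 - 2 * H).
Proof.
move=> H01 /andP[a0 ax].
have x0 : 0 < `|x| by exact: lt_trans ax.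
set y := `|x| in ax x0 *.
(* The covariance is even: for negative x the two shifted terms trade places. *)
have -> : fgn_covariance H C a x = C ^+ 2 / 2 *
    ((y + a) `^ (2 * H) + (y - a) `^ (2 * H) - 2 * y `^ (2 * H)).
  rewrite /fgn_covariance -/y; congr (_ * (_ - _)); rewrite /y.
  have [x_ge0|x_lt0] := leP 0 x.
    by rewrite /y ger0_norm// in ax *; rewrite !ger0_norm//; lra.
  rewrite /y ltr0_norm// in ax *; rewrite ltr0_norm; last lra.
  rewrite (ltr0_norm (x := x - a)); last lra.
  by rewrite addrC; congr (_ `^ _ + _ `^ _); lra.
have e1 : y + a = y * (1 + a / y) by field; rewrite gt_eqF.
have e2 : y - a = y * (1 - a / y) by field; rewrite gt_eqF.
have u0 : 0 <= a / y by rewrite divr_ge0// ltW.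
have u1 : a / y < 1 by rewrite ltr_pdivrMr// mul1r.
rewrite e1 e2 !powRM; [|lra..].
have -> : C ^+ 2 / 2 * (y `^ (2 * H) * (1 + a / y) `^ (2 * H) +
    y `^ (2 * H) * (1 - a / y) `^ (2 * H) - 2 * y `^ (2 * H)) =
    C ^+ 2 / 2 * y `^ (2 * H) *
    ((1 + a / y) `^ (2 * H) + (1 - a / y) `^ (2 * H) - 2) by ring.
rewrite normrM ger0_norm; last by rewrite mulr_ge0 ?powR_ge0// divr_ge0 ?sqr_ge0.
have -> : C ^+ 2 * a ^+ 2 / y `^ (2 - 2 * H) =
    C ^+ 2 / 2 * y `^ (2 * H) * (2 * (a / y) ^+ 2).
  have yn0 : y != 0 by rewrite gt_eqF.
  rewrite powRB ?yn0 ?implybT// (powR_mulrn 2) ?ltW//.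
  by field; rewrite !gt_eqF// powR_gt0.
apply: ler_wpM2l; first by rewrite mulr_ge0 ?powR_ge0// divr_ge0 ?sqr_ge0.
by apply: second_difference_powR => //; apply/andP.
Qed.

Lemma fgn_covariance_vanishes (R : realType) (H C a e : R) :
  0 < H < 1 -> 0 < a -> 0 < e ->
  exists K : nat, forall k : int, (K <= `|k|)%N ->
    `|fgn_covariance H C a k%:~R| <= e.
Proof.
move=> H01 a0 e0; have /andP[H0 H1] : 0 < H < 1 := H01.
set v := C ^+ 2 * a ^+ 2 / e.
have v0 : 0 <= v by apply: divr_ge0 (ltW e0); rewrite mulr_ge0 ?sqr_ge0.
have p0 : 0 < 2 - 2 * H by lra.
(* Beyond [m] both requirements hold: |k| > a, so that the bound applies, and |k| ^ (2 - 2 H) >=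
   [v], so that it is at most [e]. *)
pose m := a + v `^ (2 - 2 * H)^-1.
have m0 : 0 <= m by rewrite addr_ge0 ?powR_ge0// ltW.
exists (Num.bound m) => k Kk.
have mk : m < `|k%:~R|.
  rewrite -intr_norm -abszE -pmulrn (lt_le_trans (archi_boundP m0))//.
  by rewrite ler_nat.
have vk : v <= `|k%:~R| `^ (2 - 2 * H).
  rewrite -[leLHS]powRr1// -[X in _ `^ X](mulVf (lt0r_neq0 p0)) powRrM.
  rewrite ge0_ler_powR ?nnegrE ?powR_ge0 ?normr_ge0 ?(ltW p0)//.
  by apply/ltW/(le_lt_trans _ mk); rewrite lerDr ltW.
have ak : a < `|k%:~R| by rewrite (le_lt_trans _ mk)// lerDl powR_ge0.
rewrite (le_trans (fgn_covariance_bound C H01 _))//; first by rewrite a0.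
rewrite ler_pdivrMr; last by rewrite powR_gt0// (lt_trans a0).
by rewrite [leRHS]mulrC -ler_pdivrMr.
Qed.

(** * Averages over permutations *)

(** Only finitely many k have |k| < [K]; the sum of their values, added to the tail bound [e],
    dominates everything. *)
Lemma vanishing_bounded (R : realType) (u : int -> R) (e : R) (K : nat) :
  0 <= e -> (forall k, 0 <= u k) ->
  (forall k : int, (K <= `|k|)%N -> u k <= e) ->
  exists2 M, 0 <= M & forall k, u k <= M.
Proof.
move=> e0 u0 uK.
exists (e + \sum_(i < K) (u i%:Z + u (- i%:Z))).
  by rewrite addr_ge0// sumr_ge0// => i _; rewrite addr_ge0.
move=> k; have [/uK kK|kK] := leqP K `|k|%N.
  by rewrite (le_trans kK)// lerDl sumr_ge0// => i _; rewrite addr_ge0.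
have uk : u k <= u `|k|%N%:Z + u (- `|k|%N%:Z).
  have [->|->] : k = `|k|%N%:Z \/ k = - `|k|%N%:Z by lia.
    by rewrite absz_nat lerDl.
  by rewrite abszN absz_nat lerDr.
rewrite (le_trans uk)// (bigD1 (Ordinal kK))//= addrCA lerDl addr_ge0//.
by rewrite sumr_ge0// => i _; rewrite addr_ge0.
Qed.

(** On the window the shift c + y + K lies between 0 and 2K, where [inord] does not truncate, so the
    shift is injective. *)
Lemma card_ord_window (L K : nat) (c : int) :
  (#|[pred y : 'I_L | (`|(c + (y : nat)%:Z)%R| < K)%N]| <= (2 * K).+1)%N.
Proof.
pose f (y : 'I_L) : 'I_(2 * K).+1 := inord `|(c + (y : nat)%:Z + K%:Z)%R|%N.
rewrite -[leqRHS]card_ord -(card_in_image (f := f)) ?max_card// => y z.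
rewrite !inE => hy hz /(congr1 (@nat_of_ord _)); rewrite /f !inordK; [|lia|lia].
by move=> h; apply: ord_inj; lia.
Qed.

(** The few terms near 0 are bounded by [M], all the others by [e]. *)
Lemma sum_window_le (R : realType) (u : int -> R) (e M : R) (K L : nat) (c : int) :
  0 <= e -> 0 <= M -> (forall k, u k <= M) ->
  (forall k : int, (K <= `|k|)%N -> u k <= e) ->
  \sum_(y < L) u (c + (y : nat)%:Z) <= (2 * K).+1%:R * M + L%:R * e.
Proof.
move=> e0 M0 uM uK.
rewrite (bigID [pred y : 'I_L | (`|(c + (y : nat)%:Z)%R| < K)%N])/=.
apply: lerD.
  apply: (@le_trans _ _ (\sum_(y < L | (`|(c + (y : nat)%:Z)%R| < K)%N) M)).
    exact: ler_sum.
  rewrite sumr_const -[leLHS]mulr_natl; apply: ler_wpM2r => //; rewrite ler_nat.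
  exact: card_ord_window.
apply: (@le_trans _ _ (\sum_(y < L) e)); last by rewrite sumr_const card_ord mulr_natl.
rewrite [leRHS](bigID [pred y : 'I_L | (`|(c + (y : nat)%:Z)%R| < K)%N])/=.
rewrite -[leLHS]add0r lerD ?sumr_ge0// ler_sum// => y; rewrite -leqNgt; exact: uK.
Qed.

(* Composing with the transposition of [j] and [k] permutes 'S_n and moves
   [s j] to [s k] without touching [s i]. *)
Lemma sum_perm_pair (V : nzRingType) (n : nat) (i j : 'I_n)
    (F : 'I_n -> 'I_n -> V) :
  i != j ->
  n.-1%:R * \sum_(s : 'S_n) F (s i) (s j) =
  \sum_(s : 'S_n) \sum_(y | y != s i) F (s i) y.
Proof.
move=> ij.
have swap (k : 'I_n) : k != i ->
    \sum_(s : 'S_n) F (s i) (s k) = \sum_(s : 'S_n) F (s i) (s j).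
  move=> ki; rewrite [RHS](reindex_inj (mulgI (tperm j k))).
  apply: eq_bigr => s _; rewrite !permM tpermL tpermD//.
  by rewrite eq_sym.
transitivity (\sum_(k | k != i) \sum_(s : 'S_n) F (s i) (s k)).
  rewrite (eq_bigr _ swap) sumr_const mulr_natl; congr (_ *+ _).
  by rewrite cardC1 card_ord.
rewrite exchange_big; apply: eq_bigr => s _.
rewrite [RHS](reindex_inj (@perm_inj _ s)); apply: eq_bigl => k.
by rewrite (inj_eq perm_inj).
Qed.

(** Given s i, the point s j is uniform over the [n] remaining ones. Adding the nonnegative diagonal
    term completes the row sum bounded by [A]. *)
Lemma perm_average_le (R : realType) (n : nat) (i j : 'I_n.+1) (A : R)
    (F : 'I_n.+1 -> 'I_n.+1 -> R) :
  i != j -> (0 < n)%N -> (forall x y, 0 <= F x y) ->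
  (forall x, \sum_y F x y <= A) ->
  (n.+1)`!%:R^-1 * \sum_(s : 'S_n.+1) F (s i) (s j) <= A / n%:R.
Proof.
move=> ij n0 F0 FA.
rewrite mulrC ler_pdivrMr ?ltr0n ?fact_gt0// mulrAC ler_pdivlMr ?ltr0n//.
rewrite mulrC (sum_perm_pair F ij).
apply: (@le_trans _ _ (\sum_(s : 'S_n.+1) A)).
  apply: ler_sum => s _; apply: le_trans (FA (s i)).
  by rewrite [leRHS](bigID (fun y => y != s i))/= lerDl sumr_ge0.
by rewrite sumr_const card_Sn mulr_natr.
Qed.

Lemma perm_average_window (R : realType) (r : int -> R) (n : nat)
    (i j : 'I_n.+1) (c : int) (e M : R) (K : nat) :
  i != j -> (0 < n)%N -> 0 <= e -> 0 <= M -> (forall k, `|r k| <= M) ->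
  (forall k : int, (K <= `|k|)%N -> `|r k| <= e) ->
  `|(n.+1)`!%:R^-1 * \sum_(s : 'S_n.+1) r (c + (s i : nat)%:Z - (s j : nat)%:Z)|
    <= ((2 * K).+1%:R * M + n.+1%:R * e) / n%:R.
Proof.
move=> ij n0 e0 M0 rM rK.
rewrite normrM ger0_norm ?invr_ge0//.
apply: (@le_trans _ _ (n.+1`!%:R^-1 * \sum_(s : 'S_n.+1)
    `|r (c + (s i : nat)%:Z - (s j : nat)%:Z)|)).
  by rewrite ler_wpM2l ?invr_ge0// ler_norm_sum.
apply: (perm_average_le (F := fun x y : 'I_n.+1 =>
  `|r (c + (x : nat)%:Z - (y : nat)%:Z)|)) => // x.
(* Negation turns the arguments into an increasing run of consecutive integers; the condition on |k|
   is symmetric. *)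
under eq_bigr => y _ do rewrite -[c + _ - _]opprK opprB addrC.
apply: (@sum_window_le _ (fun k => `|r (- k)|)) => // k kK.
by apply: rK; rewrite abszN.
Qed.

(** Equal residues would make n + 1 divide q, although 0 < |q| < n + 1. *)
Lemma modz_ord_neq (n : nat) (l q : int) : q != 0 -> (`|q| <= n)%N ->
  inord `|(l %% n.+1%:Z)%Z|%N != inord `|((l + q) %% n.+1%:Z)%Z|%N :> 'I_n.+1.
Proof.
move=> q0 qn; apply/eqP => /(congr1 (@nat_of_ord _)).
have m0 x : 0 <= (x %% n.+1%:Z)%Z by rewrite modz_ge0.
have mL x : (x %% n.+1%:Z)%Z < n.+1%:Z by rewrite ltz_pmod.
have absm x : (`|(x %% n.+1%:Z)%Z| < n.+1)%N by rewrite -ltz_nat gez0_abs.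
rewrite !inordK// => /(congr1 Posz); rewrite !gez0_abs// => /esym/eqP.
rewrite eqz_mod_dvd addrAC subrr add0r dvdzE/= => /dvdn_leq.
by rewrite absz_gt0 => /(_ q0); rewrite leqNgt ltnS qn.
Qed.

(** * Independent mixtures *)

(* Independence says that the restriction of [P] to [A] and [P A] times [P]
   have the same image under [f]. *)
Lemma ge0_integral_indep_event d d' (T : measurableType d)
    (T' : measurableType d') (R : realType) (P : probability T R)
    (A : set T) (f : T -> T') (g : T' -> \bar R) :
  measurable A -> measurable_fun setT f -> measurable_fun setT g ->
  (forall y, 0 <= g y)%E ->
  (forall S, measurable S -> P (A `&` f @^-1` S) = P A * P (f @^-1` S))%E ->
  (\int[P]_(x in A) g (f x) = P A * \int[P]_x g (f x))%E.
Proof.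
move=> mA mf mg g0 Af.
have fPA : P A \is a fin_num by exact: fin_num_measure.
pose k : {nonneg R} := NngNum (fine_ge0 (measure_ge0 P A)).
have kE : k%:num%:E = P A by rewrite /k/= fineK.
transitivity (\int[pushforward (mrestr P mA) f]_y g y)%E.
  rewrite ge0_integral_pushforward// preimage_setT.
  have mgf D : measurable_fun D (g \o f) by exact/measurable_funTS/measurableT_comp.
  have mAC := measurableC mA.
  have AC : [disjoint A & ~` A] by rewrite disj_set2E setICr.
  (* The restricted measure gives the complement of [A] mass 0 and agrees with [P] inside [A]. *)
  rewrite -[setT in RHS](setUv A) ge0_integral_setU ?setUv//; last first.
    by move=> x _; exact: g0.
  rewrite [X in (_ + X)%E]null_set_integral ?adde0//; last first.
    by rewrite /= /mrestr setICl measure0.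
  apply: eq_measure_integral => S mS SA.
  by rewrite /= /mrestr setIidl.
rewrite -kE -[X in (_ * X)%E](ge0_integral_pushforward mf P (D := setT))//.
rewrite -ge0_integral_mscale//; apply: eq_measure_integral => S mS _.
by rewrite /= /mscale/= /pushforward /mrestr setIC Af// kE.
Qed.

(** The positive and negative parts of [f] are functions of [f], so the nonnegative case applies to
    each; integrability makes both integrals finite. *)
Lemma expectation_indep_event d (T : measurableType d) (R : realType)
    (P : probability T R) (A : set T) (f : T -> R) :
  measurable A -> f \in Lfun P 1 ->
  (forall S, measurable S -> P (A `&` f @^-1` S) = P A * P (f @^-1` S))%E ->
  \1_A \* f \in Lfun P 1 /\ ('E_P[\1_A \* f] = P A * 'E_P[f])%E.
Proof.
move=> mA f1 Af.
have fi : P.-integrable setT (EFin \o f) by exact/Lfun1_integrable.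
have mf : measurable_fun setT f by apply/measurable_EFinP; case/integrableP: fi.
have e : EFin \o (\1_A \* f) = (EFin \o f) \_ A.
  apply/funext => x /=; rewrite /patch indicE.
  by case: ifPn => _; rewrite /= ?mul1r ?mul0r.
split.
  apply/Lfun1_integrable; rewrite e; apply/(integrable_mkcond _ mA).
  exact: integrableS fi.
rewrite !unlock.
rewrite (_ : (\int[P]_w ((\1_A \* f) w)%:E = \int[P]_(x in A) (f x)%:E)%E);
  last first.
  by rewrite [RHS]integral_mkcond -e.
rewrite integralE [in RHS]integralE.
have pos : (fun x => (f x)%:E)^\+%E = fun x => EFin^\+%E (f x).
  exact: (funepos_comp EFin f).
have neg : (fun x => (f x)%:E)^\-%E = fun x => EFin^\-%E (f x).
  exact: (funeneg_comp EFin f).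
have fin_pos := integrable_pos_fin_num measurableT fi.
have fin_neg := integrable_neg_fin_num measurableT fi.
rewrite muleBr; last 2 first.
- exact: fin_num_measure.
- exact: fin_num_adde_defr.
rewrite pos neg.
have mE : measurable_fun setT (@EFin R) by exact: EFin_measurable.
rewrite !(ge0_integral_indep_event mA mf _ _ Af)//.
- exact: measurable_funeneg.
- exact: measurable_funepos.
Qed.

(** The mixture is the finite sum of the [X u] times the indicators of s = u; linearity does the
    rest. *)
Lemma expectation_mixture d (T : measurableType d) (R : realType)
    (P : probability T R) (U : finType) (s : T -> U) (X : U -> T -> R) :
  (forall u, measurable (s @^-1` [set u])) ->
  (forall u, X u \in Lfun P 1) ->
  (forall u S, measurable S ->
    P (s @^-1` [set u] `&` X u @^-1` S) =
    P (s @^-1` [set u]) * P (X u @^-1` S))%E ->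
  (fun w => X (s w) w) \in Lfun P 1 /\
  ('E_P[fun w => X (s w) w] = \sum_u P (s @^-1` [set u]) * 'E_P[X u])%E.
Proof.
move=> ms X1 indep.
have E u := expectation_indep_event (ms u) (X1 u) (indep u).
pose Y u := \1_(s @^-1` [set u]) \* X u.
have -> : (fun w => X (s w) w) = \sum_(f <- [seq Y u | u : U]) f.
  apply/funext => w; rewrite big_image/= fct_sumE (bigD1 (s w))//= /Y/= indicE.
  rewrite mem_set// mul1r big1 ?addr0// => u us.
  by rewrite indicE memNset ?mul0r// => /= su; rewrite su eqxx in us.
have Y1 f : f \in [seq Y u | u : U] -> f \in Lfun P 1.
  by case/mapP => u _ ->; case: (E u).
split; first by rewrite big_seq rpred_sum.
rewrite expectation_sum// big_image/=.
by apply: eq_bigr => u _; case: (E u).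
Qed.

(** Brings events about one noise term (for the mean) or a product of two (for the covariance)
    within reach of the independence hypothesis. *)
Lemma sigma_process_measurable (T : pointedType) (R : realType) (I : Type)
    (X : I -> T -> R) (i j : I) (S : set R) : measurable S ->
  sigma_process X (X i @^-1` S) /\ sigma_process X ((X i \* X j) @^-1` S).
Proof.
move=> mS; pose G := \bigcup_(k in [set: I]) preimage_set_system setT (X k) measurable.
have mX k : measurable_fun [set: g_sigma_algebraType G] (X k).
  move=> _ B mB; apply: sub_sigma_algebra; exists k => //.
  by exists B.
split; rewrite -[X in sigma_process _ X]setTI.
  exact: mX.
exact: (measurable_funM (mX i) (mX j)).
Qed.

(** * Mean and covariance of the permuted sequence *)

Definition permuted_index (n : nat) (u : 'S_n.+1 * 'I_n.+1) (l : int) : int :=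
  (l %/ n.+1%:Z)%Z * n.+1%:Z
  + (u.1 (inord `|(l %% n.+1%:Z)%Z|%N) : nat)%:Z + (u.2 : nat)%:Z.

Section permuted_sequence.
Context (R : realType) d (T : measurableType d) (P : probability T R).
Variables (Z : int -> T -> R) (n : nat).
Variables (b : T -> 'S_n.+1) (phi : T -> 'I_n.+1).
Hypotheses (hb : uniform_rv P b) (hphi : uniform_rv P phi).
Hypothesis hind :
  independent3 P (sigma_finrv b) (sigma_finrv phi) (sigma_process Z).

(** Pairing permutation and phase makes the sequence a mixture over a single finite type. *)
Let s w := (b w, phi w).

Let s_preimage u : s @^-1` [set u] = b @^-1` [set u.1] `&` phi @^-1` [set u.2].
Proof. by case: u => x y; apply/seteqP; split => w; rewrite /s/= => -[] // -> ->. Qed.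

Let s_measurable u : measurable (s @^-1` [set u]).
Proof. by rewrite s_preimage; apply: measurableI; [apply: hb.1|apply: hphi.1]. Qed.

Let s_indep3 u D : sigma_process Z D ->
  (P (s @^-1` [set u] `&` D) =
   P (b @^-1` [set u.1]) * P (phi @^-1` [set u.2]) * P D)%E.
Proof.
by move=> ZD; rewrite s_preimage; apply: hind => //;
  [exists [set u.1]|exists [set u.2]]; rewrite ?setTI.
Qed.

Let s_prob u : (P (s @^-1` [set u]) =
  P (b @^-1` [set u.1]) * P (phi @^-1` [set u.2]))%E.
Proof.
(* The whole space is an event of the noise; with it, triple independence yields that of [b] and
   [phi]. *)
have [ZT _] := sigma_process_measurable Z 0 0 (@measurableT _ R).
by have := s_indep3 u ZT; rewrite preimage_setT setIT probability_setT mule1.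
Qed.

Let s_indep u D : sigma_process Z D ->
  (P (s @^-1` [set u] `&` D) = P (s @^-1` [set u]) * P D)%E.
Proof. by move=> ZD; rewrite s_indep3// s_prob. Qed.

Lemma permuted_sequence_Lfun1 l : (forall i, Z i \in Lfun P 1) ->
  permuted_sequence Z b phi l \in Lfun P 1.
Proof.
move=> Z1.
have [] := @expectation_mixture _ T R P _ s
  (fun u => Z (permuted_index u l)) _ _ _ => //.
  move=> u S mS; apply/s_indep.
  by case: (sigma_process_measurable Z (permuted_index u l) 0 mS).
Qed.

Lemma permuted_sequence_centered l : (forall i, Z i \in Lfun P 1) ->
  (forall i, 'E_P[Z i] = 0)%E ->
  ('E_P[permuted_sequence Z b phi l] = 0)%E.
Proof.
move=> Z1 Z0.
have [] := @expectation_mixture _ T R P _ s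
  (fun u => Z (permuted_index u l)) _ _ _ => //.
  move=> u S mS; apply/s_indep.
  by case: (sigma_process_measurable Z (permuted_index u l) 0 mS).
by move=> _ ->; rewrite big1// => u _; rewrite Z0 mule0.
Qed.

Lemma permuted_sequence_covariance (r : int -> R) l m :
  (forall i, Z i \in Lfun P 1) -> (forall i, 'E_P[Z i] = 0)%E ->
  (forall i j, Z i \* Z j \in Lfun P 1) ->
  (forall i j, 'E_P[Z i \* Z j] = (r (i - j))%:E)%E ->
  covariance P (permuted_sequence Z b phi l) (permuted_sequence Z b phi m) =
  ((n.+1)`!%:R^-1 * \sum_(x : 'S_n.+1)
     r (permuted_index (x, ord0) l - permuted_index (x, ord0) m))%:E.
Proof.
move=> Z1 Z0 ZZ1 ZZ.
have [] := @expectation_mixture _ T R P _ s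
  (fun u => Z (permuted_index u l) \* Z (permuted_index u m)) _ _ _ => //.
  move=> u S mS; apply/s_indep.
  by case: (sigma_process_measurable Z (permuted_index u l) (permuted_index u m) mS).
move=> ZtZt1 E.
rewrite covarianceE ?permuted_sequence_Lfun1//.
rewrite (permuted_sequence_centered l)// mul0e sube0.
rewrite [LHS]E.
under eq_bigr do rewrite s_prob hb.2 hphi.2 card_Sn card_ord ZZ -!EFinM.
rewrite sumEFin -mulr_sumr -(pair_bigA _ (fun x y =>
  r (permuted_index (x, y) l - permuted_index (x, y) m)))/=.
rewrite -mulrA; congr (_ * _)%:E; rewrite mulr_sumr; apply: eq_bigr => x _.
(* The phase shifts both indices equally, so the n + 1 phases contribute equal terms, cancelling
   their probability 1/(n + 1). *)
rewrite (eq_bigr (fun=> r (permuted_index (x, ord0) l - permuted_index (x, ord0) m))).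
  by rewrite sumr_const card_ord -[X in _ * X]mulr_natl mulKf// pnatr_eq0.
by move=> y _; congr r; rewrite /permuted_index/=; lia.
Qed.

End permuted_sequence.

(** * Integrability and covariance of the increments *)

Lemma square_integrable_mul d (T : measurableType d) (R : realType)
    (P : probability T R) (X Y : {RV P >-> R}) :
  ('E_P[X \* X] < +oo)%E -> ('E_P[Y \* Y] < +oo)%E -> X \* Y \in Lfun P 1.
Proof.
have sq (V : {RV P >-> R}) : ('E_P[V \* V] < +oo)%E ->
    P.-integrable setT (EFin \o (V \* V)).
  rewrite unlock => V2; apply/integrableP; split.
    exact/measurable_EFinP/measurable_funM.
  rewrite (eq_integral (fun w => ((V \* V) w)%:E))// => w _.
  by rewrite /= ger0_norm// -expr2 sqr_ge0.
move=> /sq X2 /sq Y2; apply/Lfun1_integrable.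
(* Domination by |X Y| <= X ^ 2 + Y ^ 2. *)
apply: (le_integrable measurableT _ _ (integrableD measurableT X2 Y2)).
  exact/measurable_EFinP/measurable_funM.
move=> w _; rewrite /= lee_fin normrM.
rewrite [leRHS]ger0_norm ?addr_ge0// -?expr2 ?sqr_ge0//.
rewrite -(real_normK (num_real (X w))) -(real_normK (num_real (Y w))).
by have := normr_ge0 (X w); have := normr_ge0 (Y w); nra.
Qed.

Section fractional_gaussian_noise.
Context (R : realType) d (T : measurableType d) (P : probability T R).
Variables (H C a : R) (B : R -> {RV P >-> R}).
Hypothesis hB : fractional_brownian_motion H C B.

Let B2 t s : B t \* B s \in Lfun P 1.
Proof. by apply: square_integrable_mul; rewrite (fbm_covariance hB) ?ltry. Qed.

Let B1 t : (B t : T -> R) \in Lfun P 1.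
Proof.
(* Multiplying by the constant 1 deduces integrability from the finite second moment. *)
pose one : {RV P >-> R} := cst 1%R.
have c2 : ('E_P[one \* one] < +oo)%E.
  rewrite (_ : one \* one = cst 1) ?expectation_cst ?ltry//.
  by apply/funext => w; rewrite /= mulr1.
have t2 : ('E_P[B t \* B t] < +oo)%E by rewrite (fbm_covariance hB) ?ltry.
have := square_integrable_mul t2 c2.
by rewrite (_ : B t \* one = B t)//; apply/funext => w; rewrite /= mulr1.
Qed.

Lemma fgn_Lfun1 i : fractional_gaussian_noise B a i \in Lfun P 1.
Proof. exact: rpredB (B1 _) (B1 _). Qed.

Lemma fgn_centered i : ('E_P[fractional_gaussian_noise B a i] = 0)%E.
Proof.
rewrite (_ : fractional_gaussian_noise _ _ _ = B (i%:~R + a) \- B i%:~R)//.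
by rewrite expectationB// !(fbm_centered hB) sube0.
Qed.

Let fgn_mulE i j :
  fractional_gaussian_noise B a i \* fractional_gaussian_noise B a j =
  (B (i%:~R + a) \* B (j%:~R + a) \- B (i%:~R + a) \* B j%:~R) \-
  (B i%:~R \* B (j%:~R + a) \- B i%:~R \* B j%:~R).
Proof. by apply/funext => w; rewrite /fractional_gaussian_noise/=; ring. Qed.

Lemma fgn_mul_Lfun1 i j :
  fractional_gaussian_noise B a i \* fractional_gaussian_noise B a j \in Lfun P 1.
Proof. by rewrite fgn_mulE; apply: rpredB; apply: rpredB. Qed.

(** Among the four covariances of [B] the powers of single times cancel; only powers of time
    differences remain. *)
Lemma fgn_covarianceE (i j : int) :
  ('E_P[fractional_gaussian_noise B a i \* fractional_gaussian_noise B a j] =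
   (fgn_covariance H C a (i - j)%:~R)%:E)%E.
Proof.
rewrite fgn_mulE expectationB; [|exact: rpredB|exact: rpredB].
rewrite !expectationB// !(fbm_covariance hB) -!EFinB; congr (_%:E).
rewrite /fgn_covariance rmorphB/=.
set x : R := i%:~R; set y : R := j%:~R.
have -> : x + a - (y + a) = x - y by ring.
have -> : x + a - y = x - y + a by ring.
have -> : x - (y + a) = x - y - a by ring.
by field.
Qed.

End fractional_gaussian_noise.

(** At H = 1 the noise covariance is the constant C ^ 2 a ^ 2, whence H < 1 in the limit. The index
    [l n] may vary with the block length, since the bound is uniform in the position. *)
Theorem proposition4p1 (R : realType) (d : measure_display)
    (T : measurableType d) (P : probability T R)
    (H C a : R) (hH0 : 0 < H) (hH1 : H <= 1) (ha : 0 < a)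
    (B : R -> {RV P >-> R}) (hB : fractional_brownian_motion H C B)
    (b : forall n : nat, T -> 'S_n.+1) (phi : forall n : nat, T -> 'I_n.+1)
    (hb : forall n : nat, uniform_rv P (b n))
    (hphi : forall n : nat, uniform_rv P (phi n))
    (hind : forall n : nat,
       independent3 P (sigma_finrv (b n)) (sigma_finrv (phi n))
         (sigma_process (fractional_gaussian_noise B a)))
    (q : int) (hq : q != 0) :
  let Zt (n : nat) : int -> T -> R :=
    permuted_sequence (fractional_gaussian_noise B a) (b n) (phi n) in
  (forall (n : nat) (l : int), 'E_P[Zt n l] * 'E_P[Zt n (l + q)%R] = 0)%E /\
  (H < 1 -> forall l : nat -> int,
     (fun n : nat => covariance P (Zt n (l n)) (Zt n (l n + q))) @ \oo
       --> (0 : \bar R)%E).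
Proof.
move=> Zt.
have Z1 := fgn_Lfun1 a hB.
have Z0 := fgn_centered a hB.
split=> [n l|H1 l].
  by rewrite /Zt permuted_sequence_centered ?mul0e.
have H01 : 0 < H < 1 by rewrite hH0.
pose r (k : int) := fgn_covariance H C a k%:~R.
have covE n := permuted_sequence_covariance (r := r) (hb n) (hphi n) (hind n)
  (l n) (l n + q) Z1 Z0 (fgn_mul_Lfun1 a hB) (fgn_covarianceE a hB).
under eq_cvg do rewrite /Zt covE.
apply: cvg_EFin; first exact: nearW.
apply/cvgr0Pnorm_le => e e0.
(* The final bound is ((2K + 1) M + (n + 1) e/4) / n: the first part is at most e/2 for large n, the
   second because n + 1 <= 2n. *)
have e40 : 0 < e / 4 by lra.
have [K rK] := fgn_covariance_vanishes C H01 ha e40.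
have [M M0 rM] := vanishing_bounded (u := fun k => `|r k|) (ltW e40)
  (fun=> normr_ge0 _) rK.
near=> n.
have qn : (`|q| <= n)%N by near: n; exact: nbhs_infty_ge.
have n0 : (0 < n)%N by near: n; exact: nbhs_infty_gt.
have nM : (2 * K).+1%:R * M / (e / 2) <= n%:R by near: n; exact: nbhs_infty_ger.
set L := n.+1%:Z.
(* The offset between the starts of the two blocks. *)
set c := ((l n %/ L)%Z - ((l n + q) %/ L)%Z) * L.
have := perm_average_window c (modz_ord_neq (l n) hq qn) n0 (ltW e40) M0 rM rK.
rewrite (eq_bigr (fun s : 'S_n.+1 => r (permuted_index (s, ord0) (l n) -
    permuted_index (s, ord0) (l n + q)))); last first.
  by move=> s _; congr r; rewrite /permuted_index /c /L/=; ring.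
move=> /le_trans; apply.
have n1 : (1 : R) <= n%:R by rewrite ler1n.
rewrite ler_pdivrMr ?ltr0n// -natr1.
rewrite ler_pdivrMr in nM; last lra.
nra.
Unshelve. all: end_near. Qed.
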